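(* For every $\varepsilon>0$ and all functions $g,h:\mathbb N\to\mathbb N$ there is a positive integer $N\leq\Psi(\varepsilon,g,h)$ such that $$\|T^lS_nT^nx-S_nT^nx\|<\varepsilon\quad\text{for all } n\in[N,N+g(N)]\text{ and all } l\leq h(N).$$
   Context: Conventions: $\mathbb N=\{0,1,2,\dots\}$; for $m,n\in\mathbb N$, $[m,n]$ denotes the set of natural numbers $k$ with $m\le k\le n$; sums and maxima of functions are pointwise; $\operatorname{Id}(n)=n$; for $g:\mathbb N\to\mathbb N$ put $g^M(n):=\max_{m\le n}g(m)$. Setting: $X$ is a uniformly convex real Banach space, $C\subseteq X$ is non-empty, closed and convex, $b>0$ satisfies $\|y\|\le b/2$ for all $y\in C$, and $T:C\to C$ is nonexpansive ($\|Ty-Tz\|\le\|y-z\|$ for all $y,z\in C$) and has a fixed point. For $n\ge1$ and $y\in C$, $S_ny:=\frac1n\sum_{i=0}^{n-1}T^iy$; thus $S_nT^kx=\frac1n\sum_{i=0}^{n-1}T^{k+i}x$. Modulus of convexity: $\eta:[0,\infty)\to[0,\infty)$ is a given continuous function such that $\|\frac{u+v}2\|\le1-\eta(\varepsilon)$ whenever $\varepsilon>0$, $u,v\in X$, $\|u\|,\|v\|\le1$, $\|u-v\|\ge\varepsilon$, and such that $0<s<t$ implies $0=\eta(0)<\eta(s)<\eta(t)$ and $\eta(s)/s\le\eta(t)/t$. Constants $c,q$: $X^2$ carries the norm $\|(u,v)\|_2=(\|u\|^2+\|v\|^2)^{1/2}$, and $c>0$, $q>1$ are given such that $\mathbb E(\|\sum_{i=1}^nZ_i\|_2^q)\le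 c^q\sum_{i=1}^n\mathbb E(\|Z_i\|_2^q)$ for all $n$ and all independent (Bochner integrable) mean-zero random variables $Z_1,\dots,Z_n$ with values in $X^2$. Function $\gamma$: for $t\ge0$ let $\gamma_2(t)=\min\{t,\frac b2\eta(\frac{4t}b)\}$ and $\gamma_{n+1}(t)=\min\{\gamma_n(t),\gamma_2(\gamma_n(t/2)/3)\}$ for $n\ge2$. Let $\gamma(0)=0$ and, for $t>0$, $\gamma(t)=\gamma_{p(t)}(t/3)$ with $p(t)=\max\{2,\lceil(\frac{6bc}{\sqrt2\,t})^{q/(q-1)}\rceil\}$. Rate $A$: a point $x\in C$ is fixed, $\alpha^i_n:=\|T^nx-T^{n+i}x\|$, and a map $(\varepsilon,g,h)\mapsto A(\varepsilon,g,h)\in\mathbb N$ is given such that for all $\varepsilon>0$ and $g,h:\mathbb N\to\mathbb N$ there is $N\le A(\varepsilon,g,h)$ with $|\alpha^i_m-\alpha^i_n|<\varepsilon$ for all $m,n\in[N,N+g(N)]$ and $i\le h(N)$. Derived maps, for $\varepsilon>0$ and $g,h:\mathbb N\to\mathbb N$: (1) $B(\varepsilon,g,h):=A(\gamma(\varepsilon),\hat g,\hat h)$ with $\hat g(N)=N+2g(N)+h(N)$ and $\hat h(N)=2(N+g(N))$. (2) $g_\varepsilon(n):=n'+g^M(n')$ with $n'=\max\{n,\lceil 4nb/\varepsilon\rceil\}$; $g_\varepsilon^{(0)}(n)=\max\{1,n\}$ and $g_\varepsilon^{(i+1)}(n)=g_\varepsilon(g_\varepsilon^{(i)}(n))$;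 and, with $K=\lceil 2b/\varepsilon\rceil$, $$\Theta^B(\varepsilon,g,h):=g_\varepsilon^{(K+1)}\left(B\left(\tfrac\varepsilon4,\,g_\varepsilon^{(K+2)},\,\max\{2\cdot g_\varepsilon^{(K+1)},\,h^M\circ g_\varepsilon^{(K+1)}\}\right)\right).$$ (3) $\delta(\varepsilon):=\min\{b,\frac\varepsilon4,\frac\varepsilon8\,\eta(\frac\varepsilon{2b})\}$, $g'_\varepsilon(n):=\lceil\frac{6b(n+g(n))}{\delta(\varepsilon)}\rceil$, and $\Delta^B(\varepsilon,g,h):=\Theta^B(\delta(\varepsilon),\,g+g'_\varepsilon,\,\max\{\operatorname{Id}+g+2g'_\varepsilon,\,h\})$. (4) $\Psi(\varepsilon,g,h):=\Delta^B(\frac\varepsilon4,g''_{\varepsilon,h},h)$ with $g''_{\varepsilon,h}(N):=\max\{g(N),\lceil\frac{4b\,h(N)}\varepsilon\rceil\}$. *)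

(* Defs.v *)
From HB Require Import structures.
From mathcomp Require Import all_boot all_order all_algebra.
From mathcomp Require Import all_classical all_reals all_analysis.

Set Implicit Arguments.
Unset Strict Implicit.
Unset Printing Implicit Defensive.

Import Order.TTheory GRing.Theory Num.Theory.
Import numFieldNormedType.Exports.

Local Open Scope classical_set_scope.
Local Open Scope ring_scope.

(* Only applied to nonnegative reals, so the absolute value of the integer
   ceiling is the ceiling itself. *)
Definition natceil (R : realType) (r : R) : nat := `|Num.ceil r|%N.

Definition uniformly_convex (R : realType) (X : normedModType R) : Prop :=
  forall e : R, 0 < e -> exists2 d : R, 0 < d &
    forall u v : X, `|u| <= 1 -> `|v| <= 1 -> e <= `|u - v| ->
      `|2^-1 *: (u + v)| <= 1 - d.

(* eta is a function from [0, +oo[ to [0, +oo[; its values at negative reals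
   are unconstrained and never used. *)
Definition convexity_modulus (R : realType) (X : normedModType R)
    (eta : R -> R) : Prop :=
  [/\ {within `[0, +oo[, continuous eta},
      forall t, 0 <= t -> 0 <= eta t,
      forall (e : R) (u v : X), 0 < e -> `|u| <= 1 -> `|v| <= 1 ->
        e <= `|u - v| -> `|2^-1 *: (u + v)| <= 1 - eta e &
      forall s t, 0 < s -> s < t ->
        [/\ 0 = eta 0, eta 0 < eta s, eta s < eta t & eta s / s <= eta t / t]].

Definition nonexpansive_on (R : realType) (X : normedModType R) (C : set X)
    (T : X -> X) : Prop :=
  forall y z, C y -> C z -> `|T y - T z| <= `|y - z|.

Definition ergodic_mean (R : realType) (X : normedModType R) (T : X -> X)
    (n : nat) (y : X) : X :=
  n%:R^-1 *: \sum_(i < n) iter i T y.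

Section PairRandomVariables.
Context {R : realType} {X : normedModType R}.

(* The library norm on X * X is the max norm. It is equivalent to norm2, so the
   topology of X * X (open sets, limits) is also the one given by norm2. *)
Definition norm2 (z : X * X) : R := Num.sqrt (`|z.1| ^+ 2 + `|z.2| ^+ 2).

Context {d : measure_display} {Omega : measurableType d}.
Implicit Types (P : probability Omega R) (s Z : Omega -> X * X).

Definition random_variable Z : Prop :=
  forall U : set (X * X), open U -> measurable (Z @^-1` U).

Definition simple_rv s : Prop :=
  finite_set (range s) /\ forall v, measurable (s @^-1` [set v]).

Definition simple_mean P s : X * X :=
  \sum_(v \in range s) fine (P (s @^-1` [set v])) *: v.

(* Z is Bochner integrable with respect to norm2, with integral v. *)
Definition bochner_mean P Z (v : X * X) : Prop :=
  random_variable Z /\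
  exists s : nat -> Omega -> X * X,
    [/\ forall k, simple_rv (s k),
        'E_P[fun w => norm2 (Z w - s k w)%R]%E @[k --> \oo] --> 0%E &
        simple_mean P (s k) @[k --> \oo] --> v].

(* Mutual independence; the product rule for a subfamily is the case where the
   other Borel sets are setT. *)
Definition independent_rvs P (n : nat) (Z : 'I_n -> Omega -> X * X) : Prop :=
  forall B : 'I_n -> set (X * X),
    (forall i, <<s @open (X * X)%type >> (B i)) ->
    P (\bigcap_(i in [set: 'I_n]) (Z i @^-1` B i)) =
    (\prod_(i < n) P (Z i @^-1` B i))%E.

End PairRandomVariables.

Definition type_inequality (R : realType) (X : normedModType R) (c q : R)
    : Prop :=
  forall (d : measure_display) (Omega : measurableType d)
    (P : probability Omega R) (n : nat) (Z : 'I_n -> Omega -> X * X),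
    (forall i, bochner_mean P (Z i) 0) -> independent_rvs P Z ->
    ('E_P[fun w => (norm2 (\sum_(i < n) Z i w) `^ q)%R] <=
      (c `^ q)%:E * \sum_(i < n) 'E_P[fun w => (norm2 (Z i w) `^ q)%R])%E.

Definition gamma2 (R : realType) (b : R) (eta : R -> R) (t : R) : R :=
  Num.min t (b / 2 * eta (4 * t / b)).

(* gammaS b eta k is the function gamma_(k + 2). *)
Fixpoint gammaS (R : realType) (b : R) (eta : R -> R) (k : nat) (t : R) : R :=
  if k is k'.+1 then
    Num.min (gammaS b eta k' t) (gamma2 b eta (gammaS b eta k' (t / 2) / 3))
  else gamma2 b eta t.

Definition gamma_index (R : realType) (b c q t : R) : nat :=
  maxn 2 (natceil ((6 * b * c / (Num.sqrt 2 * t)) `^ (q / (q - 1)))).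

Definition gamma (R : realType) (b c q : R) (eta : R -> R) (t : R) : R :=
  if 0 < t then gammaS b eta (gamma_index b c q t - 2) (t / 3) else 0.

Definition rate (R : realType) := R -> (nat -> nat) -> (nat -> nat) -> nat.

Definition displacement (R : realType) (X : normedModType R) (T : X -> X)
    (x : X) (i n : nat) : R :=
  `|iter n T x - iter (n + i) T x|.

Definition displacement_rate (R : realType) (X : normedModType R) (T : X -> X)
    (x : X) (A : rate R) : Prop :=
  forall (e : R) (g h : nat -> nat), 0 < e ->
    exists2 N, (N <= A e g h)%N &
      forall m n i, (N <= m <= N + g N)%N -> (N <= n <= N + g N)%N ->
        (i <= h N)%N ->
        `|displacement T x i m - displacement T x i n| < e.

Section DerivedRates.
Context {R : realType}.
Variable b : R.
Implicit Types (A B : rate R) (e : R) (g h : nat -> nat) (eta : R -> R).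

Definition rateB (c q : R) eta A : rate R := fun e g h =>
  A (gamma b c q eta e)
    (fun N => N + 2 * g N + h N)%N (fun N => 2 * (N + g N))%N.

Definition fmax g (n : nat) : nat := (\max_(m < n.+1) g m)%N.

Definition gstep e g (n : nat) : nat :=
  let n' := maxn n (natceil (4 * n%:R * b / e)) in (n' + fmax g n')%N.

Definition giter e g (i n : nat) : nat := iter i (gstep e g) (maxn 1 n).

Definition Theta B : rate R := fun e g h =>
  let K := natceil (2 * b / e) in
  giter e g K.+1
    (B (e / 4) (giter e g K.+2)
       (fun n => maxn (2 * giter e g K.+1 n) (fmax h (giter e g K.+1 n)))).

Definition delta eta e : R :=
  Num.min b (Num.min (e / 4) (e / 8 * eta (e / (2 * b)))).

Definition gprime eta e g (n : nat) : nat :=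
  natceil (6 * b * (n + g n)%:R / delta eta e).

Definition Delta eta B : rate R := fun e g h =>
  Theta B (delta eta e)
    (fun n => g n + gprime eta e g n)%N
    (fun n => maxn (n + g n + 2 * gprime eta e g n) (h n)).

Definition Psi eta B : rate R := fun e g h =>
  Delta eta B (e / 4) (fun N => maxn (g N) (natceil (4 * b * (h N)%:R / e))) h.

End DerivedRates.

(* Main.v *)
(* Bruck's inequality: a nonexpansive T is approximately affine, with an error
   t as soon as |x_i - x_j| - |T x_i - T x_j| < gamma t for all points x_i of a
   convex combination.  For two points this is the modulus of convexity applied
   to two chords; n + 1 points reduce to n points by merging the last point into
   the others; and the type inequality in X^2, applied to independent draws of
   the points (x_i, T x_i) according to their weights, replaces an arbitrary
   convex combination by a mean of p(t) points.  The rate A makes Bruck's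
   hypothesis available for T^l and for the points T^k x with k in a window.
   Hence T^l S_n T^n x is close to S_n T^(n+l) x, so that the distance of S_n T^n x
   to a fixed point f is almost nonincreasing, whence metastable.  Uniform
   convexity then forces S_n T^n x and S_m T^m x to be close, since T is also
   almost affine at their midpoint and a mean S_p T^p x with p much larger is
   almost a mean of iterates of that midpoint. *)

Require Import Defs.
From HB Require Import structures.
From mathcomp Require Import all_boot all_order all_algebra.
From mathcomp Require Import all_classical all_reals all_analysis.
From mathcomp Require Import ring lra zify.
Import Order.TTheory GRing.Theory Num.Theory.
Import numFieldNormedType.Exports.
Local Open Scope classical_set_scope.
Local Open Scope ring_scope.

Set Implicit Arguments.
Unset Strict Implicit.
Unset Printing Implicit Defensive.

(** * Selection from the type inequality *)

Lemma atomic_probability {R : realType} (m : nat) (w : nat -> R) :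
  (forall k, 0 <= w k) -> \sum_(k < m) w k = 1 ->
  exists P : probability nat R,
    forall A, P A = (\sum_(k < m) w k * ((k : nat) \in A)%:R)%:E.
Proof.
move=> w0 w1.
pose mu := msum (fun k => mscale (NngNum (w0 k)) (\d_k : measure nat R)) m.
have muE A : mu A = (\sum_(k < m) w k * ((k : nat) \in A)%:R)%:E.
  by rewrite /mu /msum -sumEFin; apply: eq_bigr => k _; rewrite /mscale.
have mu1 : mu [set: nat] = 1%E.
  rewrite muE -[in RHS]w1; congr (_%:E); apply: eq_bigr => k _.
  by rewrite in_setT mulr1.
pose mm := Measure_isProbability.Build _ _ _ mu mu1.
pose P : probability nat R := HB.pack mu mm.
by exists P.
Qed.

(* The finite sample space is encoded in nat, where every set is measurable. *)
Lemma finite_probability {R : realType} (F : finType) (f0 : F) (wt : F -> R) :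
  (forall f, 0 <= wt f) -> \sum_f wt f = 1 ->
  exists (P : probability nat R) (D : nat -> F),
    (forall f, exists k, D k = f) /\
    forall A : set F, P (D @^-1` A) = (\sum_f wt f * (f \in A)%:R)%:E.
Proof.
move=> wt0 wt1; pose D k := nth f0 (enum F) k.
have sumD (G : F -> R) : \sum_(k < size (enum F)) G (D k) = \sum_f G f.
  by rewrite -[RHS]big_enum (big_nth f0) big_mkord.
have [|//|P PE] := @atomic_probability R (size (enum F)) (wt \o D).
  by move=> k; apply: wt0.
  by rewrite sumD.
exists P, D; split=> [f|A].
  by exists (index f (enum F)); rewrite /D nth_index ?mem_enum.
rewrite PE -(sumD (fun f => wt f * (f \in A)%:R)); congr (_%:E).
Qed.

(** Under the product weights on draws [f], the coordinate [f i] has law [lam]: once the product is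
    distributed over the sums, every factor other than the [i]-th sums to 1. *)
Lemma sum_prod_marginal {R : comPzRingType} (p r : nat) (lam : 'I_r -> R)
    (i : 'I_p) (G : 'I_r -> R) :
  \sum_k lam k = 1 ->
  \sum_(f : {ffun 'I_p -> 'I_r}) (\prod_j lam (f j)) * G (f i)
    = \sum_k lam k * G k.
Proof.
move=> lam1.
pose F j k := lam k * (if j == i then G k else 1).
transitivity (\sum_(f : {ffun 'I_p -> 'I_r}) \prod_j F j (f j)).
  apply: eq_bigr => f _; rewrite /F big_split /=; congr (_ * _).
  by rewrite -big_mkcond /= big_pred1_eq.
rewrite -bigA_distr_bigA /= (bigD1 i) //= [X in _ * X]big1 => [|j ji].
  by rewrite mulr1; apply: eq_bigr => k _; rewrite /F eqxx.
by rewrite -[RHS]lam1; apply: eq_bigr => k _; rewrite /F (negPf ji) mulr1.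
Qed.

Lemma expectation_nat_le {R : realType} (P : probability nat R) (Y1 Y2 : nat -> R) :
  (forall w, 0 <= Y1 w) -> (forall w, Y1 w <= Y2 w) -> ('E_P[Y1] <= 'E_P[Y2])%E.
Proof.
move=> Y10 Y12; apply: expectation_le => //.
- by move=> w; apply: le_trans (Y12 w).
- by apply: aeW => w; apply: Y12.
Qed.

Lemma norm2_ge0 {R : realType} {X : normedModType R} (z : X * X) : 0 <= norm2 z.
Proof. exact: sqrtr_ge0. Qed.

Lemma norm20 {R : realType} {X : normedModType R} : norm2 (0 : X * X) = 0.
Proof. by rewrite /norm2 /= normr0 expr0n addr0 sqrtr0. Qed.

(** The family [z] may repeat values, so the sum over the range of [Z] is regrouped: after
    exchanging the sums, each index [k] meets only the value [z k]. *)
Lemma simple_mean_finite {R : realType} {X : normedModType R}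
    (P : probability nat R) (Z : nat -> X * X) (r : nat) (lam : 'I_r -> R)
    (z : 'I_r -> X * X) :
  finite_set (range Z) -> (forall k, exists w, Z w = z k) ->
  (forall B, P (Z @^-1` B) = (\sum_k lam k * (z k \in B)%:R)%:E) ->
  simple_mean P Z = \sum_k lam k *: z k.
Proof.
move=> Zfin Zz PE.
rewrite /simple_mean fsbig_finite //=.
under eq_bigr => v _ do rewrite PE /= scaler_suml.
rewrite exchange_big /=; apply: eq_bigr => k _.
rewrite (bigD1_seq (z k)) ?finmap.fset_uniq //=; last first.
  by rewrite in_fset_set // inE; have [w <-] := Zz k; exists w.
rewrite big1 ?addr0 => [|v /eqP vz]; first by rewrite mem_set // mulr1.
by rewrite memNset ?mulr0 ?scale0r // => /esym.
Qed.

(* An average of norms is at least its least value, attained by some draw f. *)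
Lemma type_inequality_selection {R : realType} {X : normedModType R} (c q M : R)
    (r p : nat) (lam : 'I_r -> R) (z : 'I_r -> X * X) :
  0 <= q -> type_inequality X c q ->
  (forall k, 0 <= lam k) -> \sum_k lam k = 1 -> \sum_k lam k *: z k = 0 ->
  (forall k, norm2 (z k) <= M) ->
  exists f : {ffun 'I_p -> 'I_r},
    norm2 (\sum_i z (f i)) `^ q <= c `^ q * (p%:R * M `^ q).
Proof.
move=> q0 Xcq lam0 lam1 z0 zM.
case: r lam z lam0 lam1 z0 zM => [|r] lam z lam0 lam1 z0 zM.
  by move/eqP: lam1; rewrite big_ord0 eq_sym oner_eq0.
pose f0 : {ffun 'I_p -> 'I_r.+1} := [ffun => ord0].
pose wt (f : {ffun 'I_p -> 'I_r.+1}) := \prod_i lam (f i).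
have [||P [D [Dsurj PD]]] := @finite_probability R _ f0 wt.
- by move=> f; apply: prodr_ge0.
- by rewrite -(@bigA_distr_bigA _ _ _ _ _ _ _ (fun (_ : 'I_p) => lam)) big1.
pose Z i w := z (D w i).
have PZ i B : P (Z i @^-1` B) = (\sum_k lam k * (z k \in B)%:R)%:E.
  rewrite (PD [set f | B (z (f i))]).
  rewrite -(sum_prod_marginal i (fun k => (z k \in B)%:R)) //.
have Zfin i : finite_set (range (Z i)).
  apply: (@sub_finite_set _ _ (range z)); last exact: finite_image.
  by move=> _ [w _ <-]; exists (D w i).
(* [Z i] takes finitely many values, so the constant sequence [Z i] serves as its own approximation
   by simple functions. *)
have Zmean i : bochner_mean P (Z i) 0.
  split; first by [].
  exists (fun=> Z i); split=> //.
  - rewrite [X in X @ _](_ : _ = fun=> 0%E); first exact: cvg_cst.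
    apply/funext => k; rewrite -[RHS](expectation_cst P 0); congr ('E_P[_])%E.
    by apply/funext => w; rewrite subrr norm20.
  - rewrite (@simple_mean_finite _ _ P _ _ lam z) ?z0 //; first exact: cvg_cst.
    by move=> k; have [w wk] := Dsurj [ffun => k]; exists w; rewrite /Z wk ffunE.
have Zindep : independent_rvs P Z.
  move=> B _.
  (* The joint event is the preimage of a box of draws. Its indicator, like the weight of a draw, is
     a product over the coordinates, whence the product rule. *)
  rewrite (_ : \bigcap_(_ in _) _ = D @^-1` [set f | forall i, B i (z (f i))]).
    rewrite PD; under [RHS]eq_bigr => i _ do rewrite PZ.
    rewrite prodEFin bigA_distr_bigA /=; congr (_%:E); apply: eq_bigr => f _.
    rewrite big_split /=; congr (_ * _).
    have [Bf|/existsNP[i nBf]] := pselect (forall i, B i (z (f i))).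
      by rewrite mem_set // big1 // => i _; rewrite mem_set.
    rewrite memNset => [|Bf]; last exact: nBf.
    by rewrite (bigD1 i) //= memNset // mul0r.
  by apply/seteqP; split=> w /= Bw => [i|i _]; apply: Bw.
have EZ i : ('E_P[fun w => (norm2 (Z i w) `^ q)%R] <= (M `^ q)%:E)%E.
  rewrite -(expectation_cst P); apply: expectation_nat_le => w.
    exact: powR_ge0.
  by apply: ge0_ler_powR; rewrite ?nnegrE ?norm2_ge0 ?zM // (le_trans (norm2_ge0 _) (zM (D w i))).
case: (@arg_minP _ _ _ f0 predT (fun f => norm2 (\sum_i z (f i)) `^ q)) => // f _ fmin.
exists f; rewrite -lee_fin.
apply: le_trans (le_trans (Xcq _ _ P p Z Zmean Zindep) _).
  rewrite -(expectation_cst P); apply: expectation_nat_le => w.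
    exact: powR_ge0.
  exact: fmin.
rewrite EFinM lee_wpmul2l ?lee_fin ?powR_ge0 //.
apply: (@le_trans _ _ (\sum_(i < p) (M `^ q)%:E)%E); first exact: lee_sum.
by rewrite sumEFin sumr_const card_ord mulr_natl.
Qed.

(** * Approximate affinity of nonexpansive maps *)

Lemma eta_gt0 {R : realType} {X : normedModType R} (eta : R -> R) :
  convexity_modulus X eta -> forall t, 0 < t -> 0 < eta t.
Proof.
case=> _ _ _ etaM t t0; have [] := etaM t (t + t) t0; last by move=> <-.
by rewrite ltrDl.
Qed.

Lemma eta_ratio {R : realType} {X : normedModType R} (eta : R -> R) :
  convexity_modulus X eta -> forall s t, 0 < s -> s <= t ->
  eta s <= eta t /\ eta s / s <= eta t / t.
Proof.
case=> _ _ _ etaM s t s0; rewrite le_eqVlt => /predU1P[->//|st].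
by have [_ _ /ltW ? ?] := etaM s t s0 st.
Qed.

(** For [a <= 1 / 2] the point lies between [v] and the midpoint, with weight [2 * a] on the
    midpoint. The modulus at the midpoint gives a gain [2 * a * eta], and the factor [1 - a] makes
    the bound symmetric in [u] and [v]. *)
Lemma norm_segment_le {R : realType} {X : normedModType R} (eta : R -> R)
    (u v : X) (a : R) :
  convexity_modulus X eta -> `|u| <= 1 -> `|v| <= 1 -> 0 <= a <= 1 ->
  `|a *: u + (1 - a) *: v| <= 1 - 2 * a * (1 - a) * eta `|u - v|.
Proof.
move=> Xeta; have [_ eta0 etaX etaM] := Xeta.
wlog a2 : a u v / a <= 1 / 2 => [wlg|u1 v1 /andP[a0 a1]].
  move=> u1 v1 a01; have [a2|a2] := leP a (1 / 2); first exact: wlg.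
  have a2' : 1 - a <= 1 / 2 by lra.
  rewrite [a *: u + _]addrC.
  have := wlg (1 - a) v u a2' v1 u1; rewrite subKr distrC => wlga.
  by rewrite [2 * a * _]mulrAC; apply: wlga; lra.
(* The modulus inequality concerns positive separations; for [u = v] the bound rests on
   [eta 0 = 0]. *)
have [->|uv] := eqVneq u v.
  rewrite subrr normr0; have [<- _ _ _] := etaM 1 2 ltr01 (ltr1n _ 2).
  by rewrite mulr0 subr0 -scalerDl subrKC scale1r.
have uv0 : 0 < `|u - v| by rewrite normr_gt0 subr_eq0.
have -> : a *: u + (1 - a) *: v = (1 - 2 * a) *: v + (2 * a) *: (2^-1 *: (u + v)).
  rewrite scalerA mulrAC mulfV ?pnatr_eq0 // mul1r scalerDr addrCA -scalerDl.
  by congr (_ + _ *: _); ring.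
apply: le_trans (ler_normD _ _) _.
have n1 : 0 <= 1 - 2 * a by lra.
have n2 : 0 <= 2 * a by lra.
rewrite 2!normrZ (ger0_norm n1) (ger0_norm n2).
have := etaX _ _ _ uv0 u1 v1 (lexx _); have := eta0 _ (ltW uv0).
move: (eta _) (`|2^-1 *: _|) => E N E0 NE.
have : (1 - 2 * a) * `|v| <= (1 - 2 * a) * 1 by apply: ler_wpM2l.
have : (2 * a) * N <= (2 * a) * (1 - E) by apply: ler_wpM2l.
have : 0 <= a * a * E by rewrite !mulr_ge0.
lra.
Qed.

Definition segment_closed {R : realType} {X : normedModType R} (C : set X) :=
  forall (y z : X) (a : R), C y -> C z -> 0 <= a <= 1 ->
    C (a *: y + (1 - a) *: z).

Lemma convex_set_segment {R : realType} {X : normedModType R} (C : set X) :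
  @convex_set R X C -> segment_closed C.
Proof.
move=> Cc y z a Cy Cz a01.
case/andP: a01 => a0 a1; have := Cc y z (Itv01 a0 a1).
by rewrite !inE; apply.
Qed.

(** By contraposition: with [s = a * (1 - a) * |x1 - x2|], a defect [w] separates two normalised
    chords from [T z] by [|w| / s], and [norm_segment_le] turns this into a loss of at least
    [2 * s * eta (|w| / s)] in the distance of the images. If [t <= |w|], this loss is at least
    [b / 2 * eta (4 * t / b)]. *)
Lemma gamma2_affine {R : realType} {X : normedModType R} (C : set X) (b : R)
    (eta : R -> R) (T : X -> X) (x1 x2 : X) (a t : R) :
  convexity_modulus X eta -> segment_closed C -> nonexpansive_on C T ->
  C x1 -> C x2 -> `|x1 - x2| <= b -> 0 <= a <= 1 -> 0 < t ->
  `|x1 - x2| - `|T x1 - T x2| < gamma2 b eta t ->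
  `|T (a *: x1 + (1 - a) *: x2) - (a *: T x1 + (1 - a) *: T x2)| < t.
Proof.
move=> Xeta Cc Tne C1 C2 xb a01 t0; apply: contraTT.
set z := (X in T X); set w := (X in `|X|); rewrite -!leNgt => tw.
have Cz : C z by apply: Cc.
have w0 : 0 < `|w| by apply: lt_le_trans tw.
have [a_0|a_0] := eqVneq a 0.
  by move: w0; rewrite /w /z a_0 subr0 !scale0r !add0r !scale1r subrr normr0 ltxx.
have [a_1|a_1] := eqVneq a 1.
  by move: w0; rewrite /w /z a_1 subrr !scale0r !addr0 !scale1r subrr normr0 ltxx.
have [x12|x12] := eqVneq x1 x2.
  move: w0; rewrite /w /z x12 -!scalerDl subrKC !scale1r.
  by rewrite subrr normr0 ltxx.
have {a_0} a0 : 0 < a by rewrite lt_def a_0; case/andP: a01.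
have {a_1} a1 : 0 < 1 - a by rewrite subr_gt0 lt_def eq_sym a_1; case/andP: a01.
set D := `|x1 - x2|.
have D0 : 0 < D by rewrite normr_gt0 subr_eq0.
(* [u] and [v] are chords of norm at most 1, [u - v] is proportional to [w] and
   [a v + (1 - a) u] to [T x1 - T x2]. *)
pose u := ((1 - a) * D)^-1 *: (T x1 - T z).
pose v := (a * D)^-1 *: (T z - T x2).
have u1 : `|u| <= 1.
  rewrite normrZ gtr0_norm ?invr_gt0 ?mulr_gt0 // ler_pdivrMl ?mulr_gt0 // mulr1.
  apply: le_trans (Tne _ _ C1 Cz) _.
  have -> : x1 - z = (1 - a) *: (x1 - x2).
    by rewrite /z opprD addrA -{1}[x1]scale1r -scalerBl -scalerBr.
  by rewrite normrZ gtr0_norm.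
have v1 : `|v| <= 1.
  rewrite normrZ gtr0_norm ?invr_gt0 ?mulr_gt0 // ler_pdivrMl ?mulr_gt0 // mulr1.
  apply: le_trans (Tne _ _ Cz C2) _.
  have -> : z - x2 = a *: (x1 - x2).
    by rewrite /z scalerBl scale1r scalerBr [x2 - _]addrC addrA addrK.
  by rewrite normrZ gtr0_norm.
have := @norm_segment_le _ _ eta v u a Xeta v1 u1 a01.
have -> : a *: v + (1 - a) *: u = D^-1 *: (T x1 - T x2).
  rewrite !scalerA !invfM !mulrA !divff ?gt_eqF // !mul1r -scalerDr.
  by rewrite addrC addrA subrK.
pose s := a * (1 - a) * D.
have s0 : 0 < s by rewrite !mulr_gt0.
have -> : v - u = s^-1 *: w.
  have e1 : (a * D)^-1 = s^-1 * (1 - a) by rewrite /s; field; rewrite !gt_eqF.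
  have e2 : ((1 - a) * D)^-1 = s^-1 * a by rewrite /s; field; rewrite !gt_eqF.
  rewrite /u /v e1 e2 -!scalerA -scalerBr /w; congr (_ *: _).
  rewrite !scalerBr opprB addrACA -scalerDl subrK scale1r -opprD.
  by rewrite [(1 - a) *: _ + _]addrC.
rewrite !normrZ !gtr0_norm ?invr_gt0 // => H.
(* From [a * (1 - a) <= 1 / 4] and [D <= b]; this is the origin of the argument [4 * t / b] in
   [gamma2]. *)
have sb : s <= b / 4.
  have : 0 <= (1 - 2 * a) ^+ 2 * D by rewrite mulr_ge0 ?sqr_ge0 // ltW.
  by rewrite /s; move: xb; rewrite -/D; nra.
have b0 : 0 < b by apply: lt_le_trans xb.
have s4 : 4 * t / b <= s^-1 * `|w|.
  rewrite ler_pdivrMr // -mulrA ler_pdivlMl // mulrC -mulrA [t * s]mulrC mulrA.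
  by rewrite [_ * b]mulrC; apply: ler_pM => //; [apply: mulr_ge0; rewrite // ltW | exact: ltW | lra].
have s4t : 0 < 4 * t / b by rewrite divr_gt0 // mulr_gt0.
have sw0 : 0 < s^-1 * `|w| by rewrite mulr_gt0 ?invr_gt0.
have [_] := eta_ratio Xeta s4t s4.
have := eta_gt0 Xeta sw0; rewrite /gamma2 ge_min.
move: H; move: (eta (4 * t / b)) (eta (s^-1 * `|w|)) => E1 E2 H E20 E12.
apply/orP; right.
(* Monotonicity of [eta t / t] replaces the factor [s], which may be arbitrarily small, by the fixed
   factor [b / 4]. *)
have {}E12 : E1 * b * `|w| <= 4 * E2 * s * `|w|.
  apply: (@le_trans _ _ (4 * E2 * s * t)); last first.
    by rewrite ler_wpM2l // !mulr_ge0 // ltW.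
  move: E12; rewrite ler_pdivrMr // mulrAC ler_pdivlMr // => E12.
  have -> : E1 * b * `|w| = E1 * (s^-1 * `|w|) * (s * b) by field; rewrite gt_eqF.
  have -> : 4 * E2 * s * t = E2 * (4 * t / b) * (s * b) by field; rewrite gt_eqF.
  by rewrite ler_pM2r // mulr_gt0.
rewrite ler_pM2r // in E12.
have : D * (D^-1 * `|T x1 - T x2|) <= D * (1 - 2 * a * (1 - a) * E2).
  by rewrite ler_pM2l.
rewrite mulrA mulfV ?gt_eqF // mul1r.
by move: E12; rewrite /s; lra.
Qed.

Lemma sum_ord_max1 {R : realType} {V : lmodType R} (r : nat)
    (lam : 'I_r.+1 -> R) (x : 'I_r.+1 -> V) :
  (forall k, 0 <= lam k) -> \sum_k lam k = 1 -> lam ord_max = 1 ->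
  \sum_k lam k *: x k = x ord_max.
Proof.
move=> lam0 lam1 lamm.
have /eqP : \sum_(i < r) lam (widen_ord (leqnSn r) i) = 0.
  by apply/eqP; rewrite -(inj_eq (addIr (lam ord_max))) -big_ord_recr lam1 lamm add0r.
rewrite psumr_eq0 // => /allP lamw.
rewrite big_ord_recr /= lamm scale1r big1 ?add0r // => i _.
by have /= /eqP-> := lamw i (mem_index_enum _); rewrite scale0r.
Qed.

(** The last point is shared out among the others: each of them moves towards it by the proportion
    [lam ord_max], the remaining weights are rescaled to total 1, and the barycentre stays the
    same. *)
Lemma sum_merge_last {R : realType} {V : lmodType R} (r : nat)
    (lam : 'I_r.+1 -> R) (x : 'I_r.+1 -> V)
    (lam' := fun i : 'I_r => lam (widen_ord (leqnSn r) i) / (1 - lam ord_max)) :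
  \sum_k lam k = 1 -> lam ord_max != 1 ->
  \sum_i lam' i = 1 /\
  \sum_i lam' i *: ((1 - lam ord_max) *: x (widen_ord (leqnSn r) i)
    + lam ord_max *: x ord_max) = \sum_k lam k *: x k.
Proof.
move=> lam1 mu1; have mu1' : 1 - lam ord_max != 0 by rewrite subr_eq0 eq_sym.
have lam'1 : \sum_i lam' i = 1.
  rewrite /lam' -mulr_suml; apply: (canLR (mulfK mu1')).
  by rewrite mul1r -lam1 big_ord_recr /= addrK.
have lam'E i : lam' i * (1 - lam ord_max) = lam (widen_ord (leqnSn r) i).
  by rewrite /lam' divfK.
split=> //; rewrite [RHS]big_ord_recr /=.
under eq_bigr => i _ do rewrite scalerDr !scalerA lam'E.
by rewrite big_split /= -scaler_suml -mulr_suml lam'1 mul1r.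
Qed.

Lemma segment_closed_sum {R : realType} {X : normedModType R} (C : set X)
    (r : nat) (lam : 'I_r -> R) (x : 'I_r -> X) :
  segment_closed C -> (forall k, 0 <= lam k) -> \sum_k lam k = 1 ->
  (forall k, C (x k)) -> C (\sum_k lam k *: x k).
Proof.
move=> Cc; elim: r lam x => [|r IHr] lam x lam0 lam1 Cx.
  by move/eqP: lam1; rewrite big_ord0 eq_sym oner_eq0.
have lamm : lam ord_max <= 1.
  by rewrite -lam1 [leRHS](bigD1 ord_max) //= lerDl sumr_ge0.
have [mu1|mu1] := eqVneq (lam ord_max) 1.
  by rewrite sum_ord_max1.
have [lam'1 <-] := sum_merge_last x lam1 mu1.
apply: IHr => // i; first by rewrite divr_ge0 ?subr_ge0.
rewrite -[X in _ + X *: _](subKr 1); apply: Cc => //.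
by rewrite subr_ge0 lamm lerBlDr lerDl lam0.
Qed.

Section GammaAffine.
Context {R : realType} {X : normedModType R}.
Variables (C : set X) (b : R) (eta : R -> R) (T : X -> X).
Hypotheses (b_gt0 : 0 < b) (eta_mod : convexity_modulus X eta)
  (C_segment : segment_closed C) (T_fun : set_fun C C T)
  (T_ne : nonexpansive_on C T)
  (C_diam : forall y z, C y -> C z -> `|y - z| <= b).

Lemma gamma2_le t : gamma2 b eta t <= t.
Proof. by rewrite /gamma2 ge_min lexx. Qed.

Lemma gamma2_gt0 t : 0 < t -> 0 < gamma2 b eta t.
Proof.
move=> t0; rewrite /gamma2 lt_min t0 mulr_gt0 ?divr_gt0 //.
by apply: (eta_gt0 eta_mod); rewrite divr_gt0 // mulr_gt0.
Qed.

Lemma gammaS_le k t : gammaS b eta k t <= t.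
Proof.
elim: k t => [|k IHk] t /=; first exact: gamma2_le.
by rewrite ge_min IHk.
Qed.

Lemma gammaS_gt0 k t : 0 < t -> 0 < gammaS b eta k t.
Proof.
elim: k t => [|k IHk] t t0 /=; first exact: gamma2_gt0.
by rewrite lt_min IHk // gamma2_gt0 // divr_gt0 // IHk // divr_gt0.
Qed.

(** There are [k.+2] points because [gammaS b eta k] is gamma with index [k + 2]. In the induction
    step the two-point case shows that [T] is almost affine at each merged point, so the merged
    points satisfy the hypothesis at level [k] with [t / 2]. *)
Lemma gammaS_affine k t (lam : 'I_k.+2 -> R) (x : 'I_k.+2 -> X) :
  0 < t -> (forall i, 0 <= lam i) -> \sum_i lam i = 1 -> (forall i, C (x i)) ->
  (forall i j, `|x i - x j| - `|T (x i) - T (x j)| < gammaS b eta k t) ->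
  `|T (\sum_i lam i *: x i) - \sum_i lam i *: T (x i)| < t.
Proof.
elim: k t lam x => [|k IHk] t lam x t0 lam0 lam1 Cx xT.
  rewrite !big_ord_recl !big_ord0 !addr0.
  have -> : lam (lift ord0 ord0) = 1 - lam ord0.
    by rewrite -lam1 !big_ord_recl big_ord0 addr0 addrC addKr.
  have lam01 : 0 <= lam ord0 <= 1.
    by rewrite lam0 -lam1 !big_ord_recl big_ord0 addr0 lerDl lam0.
  by apply: (gamma2_affine (b := b) eta_mod C_segment T_ne); rewrite ?C_diam //; apply: xT.
have lamm : lam ord_max <= 1.
  by rewrite -lam1 [leRHS](bigD1 ord_max) //= lerDl sumr_ge0.
have [mu1|mu1] := eqVneq (lam ord_max) 1.
  have /= -> := sum_ord_max1 (T \o x) lam0 lam1 mu1.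
  by rewrite sum_ord_max1 // subrr normr0.
have [lam'1 E1] := sum_merge_last x lam1 mu1.
have [_ E2] := sum_merge_last (T \o x) lam1 mu1.
rewrite -E1 -[X in _ - X]E2 /=.
set mu := lam ord_max in lamm mu1 lam'1 *.
set wd := widen_ord _ in lam'1 *.
set lam' := fun i => lam (wd i) / (1 - mu) in lam'1.
have mu01 : 0 <= 1 - mu <= 1 by rewrite subr_ge0 lamm lerBlDr lerDl /mu lam0.
pose x' i := (1 - mu) *: x (wd i) + mu *: x ord_max.
pose Tx' i := (1 - mu) *: T (x (wd i)) + mu *: T (x ord_max).
have Cx' i : C (x' i) by rewrite /x' -[X in _ + X *: _](subKr 1); apply: C_segment.
pose s := gammaS b eta k (t / 2).
have s0 : 0 < s by apply: gammaS_gt0; rewrite divr_gt0.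
have st : s <= t / 2 by apply: gammaS_le.
have lam'0 i : 0 <= lam' i by rewrite divr_ge0 ?subr_ge0.
have xT2 i j : `|x i - x j| - `|T (x i) - T (x j)| < gamma2 b eta (s / 3).
  by apply: lt_le_trans (xT i j) _; rewrite /= ge_min lexx orbT.
have xx' i : `|T (x' i) - Tx' i| < s / 3.
  have s3 : 0 < s / 3 by rewrite divr_gt0.
  have := gamma2_affine eta_mod C_segment T_ne (Cx (wd i)) (Cx ord_max)
    (C_diam (Cx _) (Cx _)) mu01 s3 (xT2 _ _).
  by rewrite subKr.
have main : `|T (\sum_i lam' i *: x' i) - \sum_i lam' i *: T (x' i)| < t / 2.
  apply: IHk => // [|i j]; first by rewrite divr_gt0.
  rewrite -/s.
  have -> : x' i - x' j = (1 - mu) *: (x (wd i) - x (wd j)).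
    by rewrite /x' opprD addrACA subrr addr0 scalerBr.
  have e : Tx' i - Tx' j = (1 - mu) *: (T (x (wd i)) - T (x (wd j))).
    by rewrite /Tx' opprD addrACA subrr addr0 scalerBr.
  (* The budget is [s]: one third for the original pair, scaled by [1 - mu <= 1], and one third for
     the defect at each of the two merged points. *)
  have := xT2 (wd i) (wd j); have := gamma2_le (s / 3).
  have : `|Tx' i - Tx' j| <= `|T (x' i) - Tx' i| + `|T (x' i) - T (x' j)| + `|T (x' j) - Tx' j|.
    rewrite (distrC (T (x' i)) (Tx' i)).
    apply: le_trans (ler_distD (T (x' i)) _ _) _.
    by rewrite -[leRHS]addrA lerD2l ler_distD.
  rewrite e !normrZ ger0_norm; last by case/andP: mu01.
  have := xx' i; have := xx' j.
  have := T_ne (Cx (wd i)) (Cx (wd j)).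
  case/andP: mu01; nra.
have TxE : `|\sum_i lam' i *: T (x' i) - \sum_i lam' i *: Tx' i| <= s / 3.
  rewrite -sumrB; under eq_bigr => i _ do rewrite -scalerBr.
  apply: le_trans (ler_norm_sum _ _ _) _.
  have -> : s / 3 = \sum_i lam' i * (s / 3) by rewrite -mulr_suml lam'1 mul1r.
  by apply: ler_sum => i _; rewrite normrZ ger0_norm // ler_wpM2l // ltW.
(* The total error is below [t / 2 + s / 3], and [s <= t / 2]. *)
apply: le_lt_trans (ler_distD (\sum_i lam' i *: T (x' i)) _ _) _.
by lra.
Qed.

End GammaAffine.

(** * Bruck's inequality for arbitrary convex combinations *)

Lemma half_double {R : numFieldType} {V : lmodType R} (v : V) :
  2^-1 *: (v + v) = v.
Proof.
by rewrite -mulr2n -[v *+ 2]scaler_nat scalerA mulVf ?pnatr_eq0 // scale1r.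
Qed.

Lemma sum_inv_nat {R : numFieldType} (n : nat) : (0 < n)%N ->
  \sum_(i < n) n%:R^-1 = 1 :> R.
Proof.
move=> n0.
by rewrite sumr_const card_ord -[LHS]mulr_natl divff // pnatr_eq0 -lt0n.
Qed.

Lemma mean_subE {R : numFieldType} {V : lmodType R} (n : nat) (y : 'I_n -> V)
    (v : V) : (0 < n)%N ->
  n%:R^-1 *: \sum_i y i - v = n%:R^-1 *: \sum_i (y i - v).
Proof.
move=> n0; rewrite sumrB scalerBr; congr (_ - _).
rewrite sumr_const card_ord -[v *+ _]scaler_nat scalerA mulVf ?scale1r //.
by rewrite pnatr_eq0 -lt0n.
Qed.

Lemma natceil_ge {R : realType} (r : R) : 0 <= r -> r <= (natceil r)%:R.
Proof.
move=> r0; apply: le_trans (ceil_ge r) _.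
rewrite /natceil pmulrn ler_int gez0_abs // ceil_ge0.
by apply: lt_le_trans r0; rewrite ltrN10.
Qed.

Lemma le_natceil {R : realType} (r s : R) : 0 <= r -> r <= s ->
  (natceil r <= natceil s)%N.
Proof.
move=> r0 rs; rewrite /natceil -lez_nat !gez0_abs ?le_ceil // ceil_ge0.
  by apply: lt_le_trans (le_trans r0 rs); rewrite ltrN10.
by apply: lt_le_trans r0; rewrite ltrN10.
Qed.

Lemma norm2_fst {R : realType} {X : normedModType R} (z : X * X) :
  `|z.1| <= norm2 z.
Proof.
by rewrite -[leLHS]normr_id -sqrtr_sqr ler_sqrt ?lerDl ?addr_ge0 ?sqr_ge0.
Qed.

Lemma norm2_snd {R : realType} {X : normedModType R} (z : X * X) :
  `|z.2| <= norm2 z.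
Proof.
by rewrite -[leLHS]normr_id -sqrtr_sqr ler_sqrt ?lerDr ?addr_ge0 ?sqr_ge0.
Qed.

Lemma scale_pair {R : pzRingType} {V W : lmodType R} (a : R) (v : V) (w : W) :
  a *: (v, w) = (a *: v, a *: w).
Proof. by []. Qed.

Lemma sum_pair {I : finType} {V W : zmodType} (v : I -> V) (w : I -> W) :
  \sum_i (v i, w i) = (\sum_i v i, \sum_i w i).
Proof. by elim/big_rec3: _ => [|i v' w' _ _ ->]. Qed.

(** With [k = 6 * b * c / (sqrt 2 * t)], the index [p] is chosen so that [k ^ q <= p ^ (q - 1)].
    Multiplying by [p * (t / 3) ^ q] gives the claim, since [k * (t / 3) = c * sqrt 2 * b]. This
    makes the mean of [p] well chosen draws have norm at most [t / 3]. *)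
Lemma gamma_index_powR {R : realType} (b c q t : R) :
  0 < b -> 0 < c -> 1 < q -> 0 < t ->
  c `^ q * ((gamma_index b c q t)%:R * (Num.sqrt 2 * b) `^ q) <=
  ((gamma_index b c q t)%:R * (t / 3)) `^ q.
Proof.
move=> b0 c0 q1 t0; set p := gamma_index b c q t.
have q0 : 0 < q by apply: lt_trans q1.
have s20 : 0 < Num.sqrt 2 :> R by rewrite sqrtr_gt0.
have p0 : 0 < p%:R :> R by rewrite ltr0n /p /gamma_index leq_max.
pose k := c * (Num.sqrt 2 * b) / (t / 3).
have k0 : 0 < k by rewrite /k divr_gt0 ?mulr_gt0 // divr_gt0.
have kE : 6 * b * c / (Num.sqrt 2 * t) = k.
  have s2 : Num.sqrt 2 * Num.sqrt 2 = 2 :> R by rewrite -expr2 sqr_sqrtr.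
  have n1 : Num.sqrt 2 * t != 0 by rewrite gt_eqF ?mulr_gt0.
  have n2 : t / 3 != 0 by rewrite gt_eqF ?divr_gt0.
  apply/eqP; rewrite /k eqr_div //; apply/eqP.
  have -> : c * (Num.sqrt 2 * b) * (Num.sqrt 2 * t) =
    Num.sqrt 2 * Num.sqrt 2 * (c * b * t) by ring.
  by rewrite s2; field.
have : k `^ (q / (q - 1)) <= p%:R.
  apply: le_trans (natceil_ge (powR_ge0 _ _)) _.
  by rewrite -kE ler_nat leq_maxr.
move/(ge0_ler_powR (r := q - 1)); rewrite subr_ge0 (ltW q1) => /(_ isT).
rewrite !nnegrE powR_ge0 (ltW p0) => /(_ isT isT).
rewrite -powRrM divfK ?subr_eq0 ?gt_eqF // => kp.
have t3 : 0 < t / 3 by rewrite divr_gt0.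
have -> : c `^ q * (p%:R * (Num.sqrt 2 * b) `^ q) = k `^ q * (p%:R * (t / 3) `^ q).
  have sb0 : 0 <= Num.sqrt 2 * b by rewrite mulr_ge0 // ltW.
  rewrite mulrCA [RHS]mulrCA -!powRM ?(ltW c0) ?(ltW k0) ?(ltW t3) //.
  by rewrite /k divfK // gt_eqF.
rewrite (powRM q (ltW p0) (ltW t3)) mulrA ler_wpM2r ?powR_ge0 //.
have <- : p%:R `^ (q - 1) * p%:R = p%:R `^ q.
  rewrite -[X in _ * X](powRr1 (ltW p0)) -powRD ?subrK //.
  by rewrite gt_eqF ?implybT.
by rewrite ler_wpM2r // ltW.
Qed.

Section Gamma.
Context {R : realType} {X : normedModType R}.
Variables (C : set X) (b c q : R) (eta : R -> R) (T : X -> X).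
Hypotheses (b_gt0 : 0 < b) (c_gt0 : 0 < c) (q_gt1 : 1 < q)
  (Xcq : type_inequality X c q) (eta_mod : convexity_modulus X eta)
  (C_segment : segment_closed C) (T_fun : set_fun C C T)
  (T_ne : nonexpansive_on C T)
  (C_diam : forall y z, C y -> C z -> `|y - z| <= b).

Lemma gamma_gt0 t : 0 < t -> 0 < gamma b c q eta t.
Proof.
by move=> t0; rewrite /gamma t0; apply: (gammaS_gt0 b_gt0 eta_mod); rewrite divr_gt0.
Qed.

(** Centring the pairs [(x i, T (x i))] at their barycentre [(m, m')] allows one selection to
    approximate [m] and [m'] simultaneously by means [y] and [y'] of the same draws. The error [t]
    splits into thirds: [T m] to [T y], [T y] to [y'], and [y'] to [m']. *)
Lemma gamma_affine (t : R) (r : nat) (lam : 'I_r -> R) (x : 'I_r -> X) :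
  0 < t -> (forall i, 0 <= lam i) -> \sum_i lam i = 1 -> (forall i, C (x i)) ->
  (forall i j, `|x i - x j| - `|T (x i) - T (x j)| < gamma b c q eta t) ->
  `|T (\sum_i lam i *: x i) - \sum_i lam i *: T (x i)| < t.
Proof.
move=> t0 lam0 lam1 Cx; rewrite /gamma t0.
have := gamma_index_powR b_gt0 c_gt0 q_gt1 t0.
have : (2 <= gamma_index b c q t)%N by rewrite /gamma_index leq_maxl.
(* The index is at least 2, so the truncated subtraction in [gamma] is exact and [k.+2] is the
   number of draws. *)
case: (gamma_index b c q t) => [|[|k]] // _; rewrite subn2 /= => pq xT.
set m := \sum_i _ *: x i; set m' := \sum_i _.
have Cm : C m by apply: segment_closed_sum.
have Cm' : C m' by apply: segment_closed_sum => // i; apply: T_fun.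
pose z i := (x i - m, T (x i) - m').
have z0 : \sum_i lam i *: z i = 0.
  under eq_bigr => i _ do rewrite /z scale_pair.
  rewrite sum_pair; congr (_, _); under eq_bigr => i _ do rewrite scalerBr.
    by rewrite sumrB -scaler_suml lam1 scale1r subrr.
  by rewrite sumrB -scaler_suml lam1 scale1r subrr.
have zb i : norm2 (z i) <= Num.sqrt 2 * b.
  rewrite /norm2 -[b in leRHS](ger0_norm (ltW b_gt0)) -sqrtr_sqr -sqrtrM // ler_sqrt; last first.
    by rewrite mulr_ge0 ?sqr_ge0.
  rewrite mulr_natl mulr2n lerD // lerXn2r ?nnegrE ?(ltW b_gt0) //=; apply: C_diam => //.
  exact: T_fun.
have q0 : 0 < q by apply: lt_trans q_gt1.
have [f fz] := type_inequality_selection k.+2 (ltW q0) Xcq lam0 lam1 z0 zb.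
have {pq} : norm2 (\sum_i z (f i)) <= k.+2%:R * (t / 3).
  rewrite leNgt; apply/negP => tz.
  have := le_trans fz pq; rewrite leNgt gt0_ltr_powR ?nnegrE ?norm2_ge0 //.
  by rewrite mulr_ge0 // divr_ge0 // ltW.
rewrite sum_pair => nz.
pose mu (i : 'I_k.+2) : R := k.+2%:R^-1.
have mu1 : \sum_i mu i = 1 by apply: sum_inv_nat.
have mean (V : normedModType R) (y : 'I_k.+2 -> V) v :
    `|\sum_i (y i - v)| <= k.+2%:R * (t / 3) -> `|\sum_i mu i *: y i - v| <= t / 3.
  rewrite -scaler_sumr mean_subE //.
  by rewrite normrZ ger0_norm ?invr_ge0 // ler_pdivrMl.
have := mean _ (x \o f) m (le_trans (norm2_fst _) nz).
have := mean _ (T \o x \o f) m' (le_trans (norm2_snd _) nz).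
have /= := gammaS_affine b_gt0 eta_mod C_segment T_ne C_diam (k := k) (t := t / 3)
  (lam := mu) (x := x \o f) _ _ mu1 _ (fun i j => xT _ _).
set y := \sum_i _ *: x (f i); set y' := \sum_i _.
have Cy : C y by apply: segment_closed_sum => // i; rewrite invr_ge0.
have := T_ne Cm Cy; rewrite (distrC m y).
have := ler_distD (T y) (T m) m'; have := ler_distD y' (T y) m'.
move=> H1 H2 H3 /(_ _ _ _) H4 H5 H6.
have : `|T y - y'| < t / 3.
  by apply: H4 => // [|i]; rewrite ?divr_gt0 // invr_ge0.
lra.
Qed.

End Gamma.

(** * Cesaro means of an orbit *)

Lemma nonexpansive_iter {R : realType} {X : normedModType R} (C : set X)
    (T : X -> X) (l : nat) :
  set_fun C C T -> nonexpansive_on C T ->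
  set_fun C C (iter l T) /\ nonexpansive_on C (iter l T).
Proof.
move=> TC Tne; elim: l => [|l [ITC ITne]]; first by split.
split=> [y Cy|y z Cy Cz]; rewrite ?iterS.
  by apply: TC; apply: ITC.
by apply: le_trans (ITne _ _ Cy Cz); apply: Tne; apply: ITC.
Qed.

Lemma norm_mean_le {R : realType} {X : normedModType R} (n : nat)
    (y : 'I_n -> X) (v : X) (B : R) :
  (0 < n)%N -> (forall i, `|y i - v| <= B) ->
  `|n%:R^-1 *: \sum_i y i - v| <= B.
Proof.
move=> n0 yB; rewrite mean_subE //.
rewrite normrZ ger0_norm ?invr_ge0 // ler_pdivrMl ?ltr0n //.
apply: le_trans (ler_norm_sum _ _ _) _.
by apply: le_trans (ler_sum _ (fun i _ => yB i)) _; rewrite sumr_const card_ord mulr_natl.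
Qed.

Section Orbit.
Context {R : realType} {X : normedModType R}.
Variables (C : set X) (b : R) (T : X -> X) (x : X).
Hypotheses (b_gt0 : 0 < b) (C_segment : segment_closed C)
  (T_fun : set_fun C C T) (T_ne : nonexpansive_on C T)
  (C_diam : forall y z, C y -> C z -> `|y - z| <= b) (Cx : C x).

Definition orbit_mean (n k : nat) : X := ergodic_mean T n (iter k T x).

Lemma orbitC k : C (iter k T x).
Proof. by have [+ _] := nonexpansive_iter k T_fun T_ne; apply. Qed.

Lemma orbit_meanE n k :
  orbit_mean n k = n%:R^-1 *: \sum_(i < n) iter (k + i) T x.
Proof.
congr (_ *: _); apply: eq_bigr => i _.
by rewrite -iterD addnC.
Qed.

Lemma orbit_mean_comb n k :
  orbit_mean n k = \sum_(i < n) n%:R^-1 *: iter (k + i) T x.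
Proof. by rewrite orbit_meanE scaler_sumr. Qed.

Lemma orbit_meanC n k : (0 < n)%N -> C (orbit_mean n k).
Proof.
move=> n0; rewrite orbit_mean_comb; apply: segment_closed_sum => //.
- exact: sum_inv_nat.
- by move=> i; apply: orbitC.
Qed.

(** A shift of the start by one changes only the two end terms of the sum, and these are at distance
    at most [b]. *)
Lemma orbit_mean_shift p k j : (0 < p)%N ->
  `|orbit_mean p (k + j) - orbit_mean p k| <= j%:R * b / p%:R.
Proof.
move=> p0; elim: j => [|j IHj]; first by rewrite addn0 subrr normr0 !mul0r.
have p1 : 0 < p%:R :> R by rewrite ltr0n.
apply: le_trans (ler_distD (orbit_mean p (k + j)) _ _) _.
rewrite -natr1 !mulrDl addrC mul1r lerD //.
rewrite !orbit_meanE -scalerBr.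
have -> : \sum_(i < p) iter (k + j.+1 + i) T x - \sum_(i < p) iter (k + j + i) T x
   = iter (k + j + p) T x - iter (k + j) T x.
  have /= := telescope_sumr (fun i => iter (k + j + i) T x) (leq0n p).
  rewrite big_mkord addn0 sumrB => <-; congr (_ - _).
  by apply: eq_bigr => i _; congr iter; lia.
rewrite normrZ ger0_norm ?invr_ge0 // mulrC ler_wpM2r ?invr_ge0 //.
by apply: C_diam; apply: orbitC.
Qed.

(** Exchanging the two summations turns the average into a mean over [j < n] of
    [orbit_mean p (k + (d + j))], and each of these is a shift of [orbit_mean p k] by less than
    [d + n]. *)
Lemma orbit_mean_average n p k d : (0 < n)%N -> (0 < p)%N ->
  `|orbit_mean p k - p%:R^-1 *: \sum_(i < p) orbit_mean n (k + d + i)|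
    <= (d + n)%:R * b / p%:R.
Proof.
move=> n0 p0.
have -> : p%:R^-1 *: \sum_(i < p) orbit_mean n (k + d + i) =
          n%:R^-1 *: \sum_(j < n) orbit_mean p (k + (d + j)).
  under eq_bigr => i _ do rewrite orbit_meanE.
  under [in RHS]eq_bigr => i _ do rewrite orbit_meanE.
  rewrite -!scaler_sumr !scalerA mulrC exchange_big /=; congr (_ *: _).
  by do 2![apply: eq_bigr => ? _]; congr iter; lia.
rewrite distrC; apply: norm_mean_le => // j.
apply: le_trans (orbit_mean_shift _ _ p0) _.
rewrite ler_wpM2r ?invr_ge0 // ler_wpM2r ?(ltW b_gt0) // ler_nat.
by rewrite leq_add2l ltnW.
Qed.

(** The form in which Bruck's inequality enters the metastability argument. Midpoints serve uniform
    convexity, and the diagonal [n = m] compares [T^l] of a mean with the shifted mean. Lengths are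
    positive because a mean of length 0 takes the default value 0, which may lie outside [C]. *)
Definition approx_affine (e : R) (N G L : nat) :=
  forall n m l, (0 < n)%N -> (0 < m)%N -> (N <= n <= N + G)%N ->
    (N <= m <= N + G)%N -> (l <= L)%N ->
    `|iter l T (2^-1 *: (orbit_mean n n + orbit_mean m m))
      - 2^-1 *: (orbit_mean n (n + l) + orbit_mean m (m + l))| < e.

Lemma approx_affine_mean e N G L n l : approx_affine e N G L ->
  (0 < n)%N -> (N <= n <= N + G)%N -> (l <= L)%N ->
  `|iter l T (orbit_mean n n) - orbit_mean n (n + l)| < e.
Proof.
move=> H n0 nN lL; have := H _ _ _ n0 n0 nN nN lL.
by rewrite !half_double.
Qed.

Variables (c q : R) (eta : R -> R) (A : rate R).
Hypotheses (c_gt0 : 0 < c) (q_gt1 : 1 < q) (Xcq : type_inequality X c q)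
  (eta_mod : convexity_modulus X eta) (A_rate : displacement_rate T x A).

(** For [k i <= k j], the quantity in Bruck's hypothesis for [T^l] is a difference of displacements
    with step [k j - k i <= 2 * (N + g N)], taken at the times [k i] and [l + k i], both at most
    [2 * (N + g N) + h N]. This dictates the two functions passed to [A]. *)
Lemma rateB_convex_comb e g h : 0 < e ->
  exists2 N, (N <= rateB b c q eta A e g h)%N &
    forall l (r : nat) (lam : 'I_r -> R) (k : 'I_r -> nat), (l <= h N)%N ->
      (forall i, 0 <= lam i) -> \sum_i lam i = 1 ->
      (forall i, N <= k i <= 2 * (N + g N))%N ->
      `|iter l T (\sum_i lam i *: iter (k i) T x)
        - \sum_i lam i *: iter (k i + l) T x| < e.
Proof.
move=> e0.
have [N NA HN] := A_rate (fun N => N + 2 * g N + h N)%N (fun N => 2 * (N + g N))%N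
  (gamma_gt0 c q b_gt0 eta_mod e0).
exists N => // l r lam k lh lam0 lam1 kN.
have [TlC Tlne] := nonexpansive_iter l T_fun T_ne.
under [X in _ - X]eq_bigr => i _ do rewrite addnC iterD.
apply: (gamma_affine b_gt0 c_gt0 q_gt1 Xcq eta_mod C_segment TlC Tlne C_diam) => //.
  by move=> i; apply: orbitC.
move=> i j; rewrite -!iterD.
wlog kij : i j / (k i <= k j)%N => [wlg|].
  have [|/ltnW] := leqP (k i) (k j); first exact: wlg.
  by move/wlg; rewrite distrC [X in _ - X]distrC.
have := HN (k i) (l + k i)%N (k j - k i)%N.
rewrite /displacement -!addnA subnKC //.
have := kN i; have := kN j => kNj kNi.
move=> /(_ _ _ _)/(le_lt_trans (ler_norm _)); apply; lia.
Qed.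

(** The midpoint of the two means is a single convex combination of [n + m] iterates, with weights
    [1 / (2 * n)] and [1 / (2 * m)]; their indices stay below [2 * n] or [2 * m], hence in the
    admissible range. *)
Lemma rateB_approx_affine e g h : 0 < e ->
  exists2 N, (N <= rateB b c q eta A e g h)%N & approx_affine e N (g N) (h N).
Proof.
move=> e0; have [N NB HN] := rateB_convex_comb g h e0.
exists N => // n m l n0 m0 nN mN lh.
pose lam (i : 'I_(n + m)) : R :=
  match fintype.split i with inl _ => 2^-1 * n%:R^-1 | inr _ => 2^-1 * m%:R^-1 end.
pose k (i : 'I_(n + m)) : nat :=
  match fintype.split i with inl j => n + j | inr j => m + j end.
have E (V : lmodType R) (F : nat -> V) : \sum_i lam i *: F (k i) =
    2^-1 *: (n%:R^-1 *: \sum_(i < n) F (n + i)%N + m%:R^-1 *: \sum_(i < m) F (m + i)%N).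
  rewrite big_split_ord /= scalerDr !scalerA !scaler_sumr; congr (_ + _).
    by apply: eq_bigr => i _; rewrite /lam /k (unsplitK (inl i)).
  by apply: eq_bigr => i _; rewrite /lam /k (unsplitK (inr i)).
have := HN l _ lam k lh _ _ _; rewrite E (E _ (fun k => iter (k + l) T x)).
rewrite !orbit_meanE.
under [X in _ - _ *: (_ *: X + _)]eq_bigr => i _ do rewrite addnAC.
under [X in _ - _ *: (_ + _ *: X)]eq_bigr => i _ do rewrite addnAC.
apply.
- by move=> i; rewrite /lam; case: fintype.split => _; rewrite mulr_ge0 ?invr_ge0.
- rewrite big_split_ord /=.
  under eq_bigr => i _ do rewrite /lam (unsplitK (inl i)).
  under [X in _ + X]eq_bigr => i _ do rewrite /lam (unsplitK (inr i)).
  by rewrite -!mulr_sumr !sum_inv_nat // !mulr1; lra.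
- move=> i; rewrite /k; case: fintype.split => j; have := ltn_ord j; lia.
Qed.

End Orbit.

(** * Metastability *)

Lemma fmax_ge (g : nat -> nat) m n : (m <= n)%N -> (g m <= fmax g n)%N.
Proof.
by rewrite -ltnS => mn; exact: (@leq_bigmax _ (fun i : 'I_n.+1 => g i) (Ordinal mn)).
Qed.

Lemma leq_fmax (g : nat -> nat) m n : (m <= n)%N -> (fmax g m <= fmax g n)%N.
Proof.
move=> mn; apply/bigmax_leqP => i _; apply: fmax_ge.
by apply: leq_trans mn; rewrite -ltnS.
Qed.

(** * Growth and monotonicity of the iterated window function *)

Section Giter.
Context {R : realType}.
Variables (b e : R) (g : nat -> nat).
Hypotheses (b_gt0 : 0 < b) (e_gt0 : 0 < e).

(* The number written n' in the definition of g_epsilon. *)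
Definition gstart n := maxn n (natceil (4 * n%:R * b / e)).

Lemma gstepE n : gstep b e g n = (gstart n + fmax g (gstart n))%N.
Proof. by []. Qed.

Lemma gstart_ge n : (n <= gstart n)%N.
Proof. exact: leq_maxl. Qed.

(** Ensures [n * b / m <= e / 4] whenever [m] is positive and at least [gstart n]; this is the
    averaging error in the comparison of two means. *)
Lemma gstart_geR n : 4 * n%:R * b / e <= (gstart n)%:R.
Proof.
apply: (@le_trans _ _ (natceil (4 * n%:R * b / e))%:R).
  by apply: natceil_ge; rewrite divr_ge0 ?mulr_ge0 // ltW.
by rewrite ler_nat leq_maxr.
Qed.

Lemma gstart_le_gstep n : (gstart n <= gstep b e g n)%N.
Proof. by rewrite gstepE leq_addr. Qed.

Lemma leq_gstart m n : (m <= n)%N -> (gstart m <= gstart n)%N.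
Proof.
move=> mn; rewrite geq_max (leq_trans mn (gstart_ge n)) /= leq_max.
apply/orP; right; apply: le_natceil.
  by rewrite divr_ge0 ?mulr_ge0 // ltW.
by rewrite ler_pM2r ?invr_gt0 // ler_pM2r // ler_pM2l // ler_nat.
Qed.

Lemma leq_gstep m n : (m <= n)%N -> (gstep b e g m <= gstep b e g n)%N.
Proof.
by move=> /leq_gstart mn; rewrite !gstepE leq_add // leq_fmax.
Qed.

Lemma giterS i n : giter b e g i.+1 n = gstep b e g (giter b e g i n).
Proof. by []. Qed.

Lemma giter_gt0 i n : (0 < giter b e g i n)%N.
Proof.
elim: i => [|i IHi]; first by rewrite /giter /= leq_maxl.
by rewrite giterS (leq_trans IHi) // (leq_trans (gstart_ge _)) // gstart_le_gstep.
Qed.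

Lemma leq_giter i m n : (m <= n)%N -> (giter b e g i m <= giter b e g i n)%N.
Proof.
move=> mn; elim: i => [|i IHi]; last by rewrite !giterS leq_gstep.
by rewrite /giter /=; lia.
Qed.

Lemma leq_giter_index i j n : (i <= j)%N -> (giter b e g i n <= giter b e g j n)%N.
Proof.
move=> ij; rewrite -(subnKC ij); elim: (j - i)%N => [|k IHk]; first by rewrite addn0.
rewrite addnS giterS (leq_trans IHk) // (leq_trans (gstart_ge _)) //.
exact: gstart_le_gstep.
Qed.

Lemma giter_ge i n : (n <= giter b e g i n)%N.
Proof.
by apply: leq_trans (@leq_giter_index 0 i n _); rewrite // /giter /= leq_maxr.
Qed.

End Giter.

Section Ergodic.
Context {R : realType} {X : normedModType R}.
Variables (C : set X) (b : R) (T : X -> X) (x f : X) (eta : R -> R).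
Hypotheses (b_gt0 : 0 < b) (C_segment : segment_closed C)
  (T_fun : set_fun C C T) (T_ne : nonexpansive_on C T)
  (C_diam : forall y z, C y -> C z -> `|y - z| <= b) (Cx : C x)
  (Cf : C f) (Tf : T f = f) (eta_mod : convexity_modulus X eta).

Local Notation S := (orbit_mean T x).

Let SC n k : (0 < n)%N -> C (S n k).
Proof. exact: orbit_meanC C_segment T_fun T_ne Cx n k. Qed.

Lemma iter_dist_fix l y : C y -> `|iter l T y - f| <= `|y - f|.
Proof.
move=> Cy; have [_ Tlne] := nonexpansive_iter l T_fun T_ne.
have fl k : iter k T f = f by elim: k => //= k ->.
by rewrite -{1}(fl l); exact: Tlne.
Qed.

Definition mean_dist n := `|S n n - f|.

Lemma mean_dist_le n : (0 < n)%N -> mean_dist n <= b.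
Proof. by move=> n0; apply: C_diam => //; apply: SC. Qed.

(** Up to [n * b / m], the mean of length [m] is an average of means of length [n] started at
    [m + i]. Each of these is within [e] of [T^(m + i - n)] applied to [S n n], which is no farther
    from the fixed point than [S n n]. *)
Lemma mean_dist_almost_nonincreasing e N G L n m :
  approx_affine T x e N G L -> (0 < n)%N -> (n <= m)%N ->
  (N <= n <= N + G)%N -> (2 * m <= L)%N ->
  mean_dist m <= mean_dist n + e + n%:R * b / m%:R.
Proof.
move=> aff n0 nm nN mL; have m0 := leq_trans n0 nm.
have := orbit_mean_average b_gt0 T_fun T_ne C_diam Cx m 0 n0 m0.
rewrite add0n; set M := _ *: _ => SM.
have : `|M - f| <= mean_dist n + e.
  apply: norm_mean_le => // i.
  have {1}-> : (m + 0 + i = n + (m + i - n))%N by lia.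
  have lL : (m + i - n <= L)%N by have := ltn_ord i; lia.
  apply: le_trans (ler_distD (iter (m + i - n) T (S n n)) _ _) _.
  rewrite [leRHS]addrC; apply: lerD; last by apply: iter_dist_fix; apply: SC.
  rewrite distrC; apply: ltW.
  exact: approx_affine_mean aff _ _ _.
by have := ler_distD M (S m m) f; rewrite -/(mean_dist m); lra.
Qed.

(** The iterates [n_ i] of the window function produce [K + 1] successive windows, all inside the
    range where [T] is almost affine. On one of them the distance to [f] oscillates by less than
    [e], and its left end [s_ i] is the witness. *)
Lemma theta_spec (B : rate R) :
  (forall e g h, 0 < e ->
    exists2 N, (N <= B e g h)%N & approx_affine T x e N (g N) (h N)) ->
  forall e g h, 0 < e ->
  exists N, [/\ (0 < N)%N, (N <= Theta b B e g h)%N,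
    approx_affine T x (e / 4) N (g N) (h N) &
    forall n m, (N <= n <= N + g N)%N -> (N <= m <= N + g N)%N ->
      `|mean_dist n - mean_dist m| < e].
Proof.
move=> Bspec e g h e0; rewrite /Theta; set K := natceil _; set h' := (fun n => maxn _ _).
have e4 : 0 < e / 4 by rewrite divr_gt0.
have [N0 N0B aff] := Bspec _ (giter b e g K.+2) h' e4.
pose n_ i := giter b e g i N0.
pose s_ i := gstart b e (n_ i).
have s0 i : (0 < s_ i)%N by apply: leq_trans (giter_gt0 _ _ _ i N0) (gstart_ge _ _ _).
have sN i : (N0 <= s_ i)%N by apply: leq_trans (giter_ge _ _ _ i N0) (gstart_ge _ _ _).
have nS i : n_ i.+1 = (s_ i + fmax g (s_ i))%N by [].
have nK i : (i <= K)%N -> (n_ i.+1 <= n_ K.+1)%N.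
  by move=> iK; apply: leq_giter_index.
have nK2 : (n_ K.+1 <= N0 + giter b e g K.+2 N0)%N.
  by apply: leq_trans (leq_addl _ _); apply: leq_giter_index.
(* Here [n <= n_ j] and [s_ j <= m], so the averaging error is at most [e / 4]; the affinity error
   contributes the other [e / 4]. *)
have step i j n m : (i < j <= K)%N -> (s_ i <= n <= n_ i.+1)%N ->
    (s_ j <= m <= n_ j.+1)%N -> mean_dist m <= mean_dist n + e / 2.
  move=> /andP[ij jK] /andP[sn nn] /andP[sm mn].
  have n0 : (0 < n)%N := leq_trans (s0 i) sn.
  have m0 : (0 < m)%N := leq_trans (s0 j) sm.
  have nj : (n <= n_ j)%N by apply: leq_trans nn _; apply: leq_giter_index.
  have nm : (n <= m)%N by apply: leq_trans nj (leq_trans (gstart_ge _ _ _) sm).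
  have nN : (N0 <= n <= N0 + giter b e g K.+2 N0)%N.
    rewrite (leq_trans (sN i) sn) (leq_trans nj) // (leq_trans _ nK2) //.
    by apply: leq_giter_index; apply: leqW.
  have mL : (2 * m <= h' N0)%N.
    by rewrite leq_max leq_mul2l (leq_trans mn (nK j jK)).
  apply: le_trans (mean_dist_almost_nonincreasing aff n0 nm nN mL) _.
  rewrite -addrA lerD2l.
  have : n%:R * b / m%:R <= e / 4.
    rewrite ler_pdivrMr ?ltr0n //.
    have : (gstart b e (n_ j))%:R <= m%:R :> R by rewrite ler_nat.
    move/(le_trans (gstart_geR b_gt0 e0 _)).
    have : n%:R <= (n_ j)%:R :> R by rewrite ler_nat.
    by rewrite ler_pdivrMr // => /(ler_wpM2r (ltW b_gt0)); lra.
  by lra.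
(* Otherwise the distance to [f] drops by [e] inside each of the windows
   [[s_ i, n_ i.+1]], [i <= K], and increases by at most [e / 2] from one window
   to the next, so that it becomes negative. *)
have [i iK small] : exists2 i, (i <= K)%N &
    forall n m, (s_ i <= n <= n_ i.+1)%N -> (s_ i <= m <= n_ i.+1)%N ->
      `|mean_dist n - mean_dist m| < e.
  apply: contrapT => /forall2NP big.
  have {}big i : (i <= K)%N -> exists n m, [/\ (s_ i <= n <= n_ i.+1)%N,
      (s_ i <= m <= n_ i.+1)%N & mean_dist m <= mean_dist n - e].
    move=> iK; have [//|] := big i; move=> /existsNP[n /existsNP[m]].
    move=> /not_implyP[nI /not_implyP[mI /negP]]; rewrite -leNgt => nm.
    have [nm0|nm0] := lerP 0 (mean_dist n - mean_dist m).
      by exists n, m; split=> //; rewrite ger0_norm // in nm; lra.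
    by exists m, n; split=> //; rewrite ltr0_norm // in nm; lra.
  have drop j : (j <= K)%N -> exists2 m, (s_ j <= m <= n_ j.+1)%N &
      mean_dist m <= b - e - j%:R * (e / 2).
    elim: j => [|j IHj] jK; have [n [m [nI mI nm]]] := big _ jK; exists m => //.
      have n0 : (0 < n)%N by apply: leq_trans (s0 0) _; case/andP: nI.
      by have := mean_dist_le n0; lra.
    have [p pI pj] := IHj (ltnW jK).
    have : mean_dist n <= mean_dist p + e / 2 by apply: (step j j.+1); rewrite ?ltnSn.
    by rewrite -[j.+1%:R]natr1; lra.
  (* Since [K * e >= 2 * b], the bound at the last window is at most [- e]. *)
  have [m _] := drop K (leqnn K).
  have : 2 * b / e <= K%:R by apply: natceil_ge; rewrite divr_ge0 ?mulr_ge0 ?ltW.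
  rewrite ler_pdivrMr // => Kb.
  have : 0 <= mean_dist m by apply: normr_ge0.
  lra.
have sK : (s_ i <= n_ K.+1)%N by apply: leq_trans (nK i iK); rewrite nS leq_addr.
have win : (s_ i + g (s_ i) <= n_ i.+1)%N by rewrite nS leq_add2l fmax_ge.
exists (s_ i); split=> //.
- by apply: leq_trans sK _; apply: leq_giter.
- move=> n m l n0 m0 nI mI lh; apply: aff => //.
  + by have := sN i; have := nK i iK; move: nI nK2 win; lia.
  + by have := sN i; have := nK i iK; move: mI nK2 win; lia.
  + by apply: leq_trans lh _; rewrite leq_max fmax_ge ?orbT.
- move=> n m nI mI; apply: small; move: nI mI win; lia.
Qed.
End Ergodic.

(** * Closeness of the means by uniform convexity *)

Lemma midpoint_norm_le {R : realType} {X : normedModType R} (eta : R -> R)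
    (u v : X) (e r b : R) :
  convexity_modulus X eta -> 0 < e -> `|u| <= r -> `|v| <= r -> r <= b ->
  e <= `|u - v| -> `|2^-1 *: (u + v)| <= r - e / 2 * eta (e / (2 * b)).
Proof.
move=> Xeta e0 ur vr rb euv.
(* After rescaling by [r] the gain is [r * eta (e / r)]. It is made independent of [r] by
   [e / 2 <= r], from [|u - v| <= 2 * r], and by [e / (2 * b) <= e / r]. *)
have re : e / 2 <= r by have := ler_normB u v; lra.
have r0 : 0 < r by lra.
have [_ _ etaX _] := Xeta.
have nr (w : X) : `|w| <= r -> `|r^-1 *: w| <= 1.
  by move=> wr; rewrite normrZ gtr0_norm ?invr_gt0 // ler_pdivrMl // mulr1.
have er0 : 0 < e / r by rewrite divr_gt0.
have := etaX (e / r) (r^-1 *: u) (r^-1 *: v) er0 (nr _ ur) (nr _ vr).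
rewrite -scalerBr normrZ gtr0_norm ?invr_gt0 // [e / r]mulrC ler_pM2l ?invr_gt0 //.
move=> /(_ euv); rewrite -scalerDr [_ *: (_ *: _)]scalerA [2^-1 * _]mulrC -scalerA normrZ.
rewrite gtr0_norm ?invr_gt0 // ler_pdivrMl // => /le_trans; apply.
have eb0 : 0 < e / (2 * b) by rewrite divr_gt0 //; lra.
have eb : e / (2 * b) <= r^-1 * e.
  rewrite mulrC ler_pM2r // lef_pV2 ?posrE //; lra.
have [etale _] := eta_ratio Xeta eb0 eb.
rewrite mulrBr mulr1 lerD2l lerN2; apply: ler_pM => //; first lra.
exact/ltW/(eta_gt0 Xeta).
Qed.

Section Delta.
Context {R : realType} {X : normedModType R}.
Variables (C : set X) (b : R) (T : X -> X) (x f : X) (eta : R -> R).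
Hypotheses (b_gt0 : 0 < b) (C_segment : segment_closed C)
  (T_fun : set_fun C C T) (T_ne : nonexpansive_on C T)
  (C_diam : forall y z, C y -> C z -> `|y - z| <= b) (Cx : C x)
  (Cf : C f) (Tf : T f = f) (eta_mod : convexity_modulus X eta).

Local Notation S := (orbit_mean T x).
Local Notation mean_dist := (mean_dist T x f).

Let SC n k : (0 < n)%N -> C (S n k).
Proof. exact: orbit_meanC C_segment T_fun T_ne Cx n k. Qed.

Lemma delta_gt0 e : 0 < e -> 0 < delta b eta e.
Proof.
move=> e0; rewrite /delta !lt_min b_gt0 divr_gt0 //=.
by rewrite mulr_gt0 ?divr_gt0 // (eta_gt0 eta_mod) // divr_gt0 // mulr_gt0.
Qed.

(** For [p] large, [S p p] is almost the average of the midpoints of [S n (p + n + i)] and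
    [S m (p + m + i)]. Each of these is within [d] of an iterate of the midpoint [z] of [S n n] and
    [S m m], and iterating [T] does not move [z] away from [f]. *)
Lemma mean_dist_le_midpoint d N G L n m p :
  approx_affine T x d N G L -> (0 < n)%N -> (0 < m)%N ->
  (N <= n <= N + G)%N -> (N <= m <= N + G)%N -> (0 < p)%N -> (2 * p <= L)%N ->
  mean_dist p <= `|2^-1 *: ((S n n - f) + (S m m - f))| + d + (n + m)%:R * b / p%:R.
Proof.
move=> aff n0 m0 nN mN p0 pL.
pose Av (n : nat) := p%:R^-1 *: \sum_(i < p) S n (p + n + i).
pose M := 2^-1 *: (Av n + Av m).
have half0 : 0 < 2^-1 :> R by rewrite invr_gt0.
have ME : M = p%:R^-1 *: \sum_(i < p) 2^-1 *: (S n (p + n + i) + S m (p + m + i)).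
  by rewrite -scaler_sumr scalerA mulrC -scalerA big_split /= scalerDr.
(* The two averages cost [2 * n * b / p] and [2 * m * b / p]; the factor one half halves their
   sum. *)
have SM : `|S p p - M| <= (n + m)%:R * b / p%:R.
  have -> : S p p - M = 2^-1 *: ((S p p - Av n) + (S p p - Av m)).
    by rewrite addrACA -opprD scalerBr half_double.
  rewrite normrZ gtr0_norm // ler_pdivrMl //.
  apply: le_trans (ler_normD _ _) _.
  have := orbit_mean_average b_gt0 T_fun T_ne C_diam Cx p n n0 p0.
  have := orbit_mean_average b_gt0 T_fun T_ne C_diam Cx p m m0 p0.
  by rewrite -/(Av n) -/(Av m) !natrD; lra.
have Mf : `|M - f| <= `|2^-1 *: ((S n n - f) + (S m m - f))| + d.
  rewrite ME; apply: norm_mean_le => // i.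
  have lL : (p + i <= L)%N by have := ltn_ord i; lia.
  have := aff n m (p + i)%N n0 m0 nN mN lL.
  rewrite ![(_ + (p + i))%N]addnA ![(_ + p)%N]addnC.
  set z := 2^-1 *: (S n n + _) => affz.
  have Cz : C z.
    have := @C_segment (S n n) (S m m) 2^-1 (SC n n0) (SC m m0).
    rewrite (_ : 1 - 2^-1 = 2^-1 :> R); last lra.
    by rewrite -scalerDr; apply; lra.
  apply: le_trans (ler_distD (iter (p + i) T z) _ _) _.
  rewrite [leRHS]addrC distrC; apply: lerD; first exact: ltW.
  have -> : 2^-1 *: ((S n n - f) + (S m m - f)) = z - f.
    by rewrite addrACA -opprD scalerBr half_double.
  exact: (iter_dist_fix T_fun T_ne Cf Tf (p + i) Cz).
by have := ler_distD M (S p p) f; rewrite -/(mean_dist p); lra.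
Qed.

(** If [S n n] and [S m m] were [e] apart, their midpoint would be closer to [f] by
    [e / 2 * eta (e / (2 * b))], and so would [S p p] up to small errors. But [p] lies in the
    enlarged window, where the distances to [f] differ by less than [delta]. *)
Lemma delta_spec (B : rate R) :
  (forall e g h, 0 < e ->
    exists2 N, (N <= B e g h)%N & approx_affine T x e N (g N) (h N)) ->
  forall e g h, 0 < e ->
  exists N, [/\ (0 < N)%N, (N <= Delta b eta B e g h)%N,
    approx_affine T x e N (g N) (h N) &
    forall n m, (N <= n <= N + g N)%N -> (N <= m <= N + g N)%N ->
      `|S n n - S m m| < e].
Proof.
move=> Bspec e g h e0; have d0 := delta_gt0 e0.
have [N [N0 NT aff distN]] := theta_spec b_gt0 C_segment T_fun T_ne C_diam Cx
  Cf Tf Bspec (fun n => g n + gprime b eta e g n)%N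
  (fun n => maxn (n + g n + 2 * gprime b eta e g n) (h n)) d0.
exists N; split=> //.
  move=> n m l n0 m0 nN mN lh.
  apply: lt_trans (aff _ _ _ n0 m0 _ _ _) _; [lia|lia|by rewrite leq_max lh orbT|].
  have : delta b eta e <= e / 4 by rewrite /delta !ge_min lexx !orbT.
  lra.
move=> n m nN mN; rewrite ltNge; apply/negP => enm.
have n0 : (0 < n)%N by lia.
have m0 : (0 < m)%N by lia.
move: aff distN => /=; set p := gprime _ _ _ _ _ => aff distN.
have pd : 6 * b * (N + g N)%:R <= delta b eta e * p%:R.
  rewrite -ler_pdivrMl // mulrC; apply: natceil_ge.
  by apply: divr_ge0 (ltW d0); rewrite !mulr_ge0 // ltW.
(* The entry [b] in the minimum defining [delta] serves here: it puts [p] beyond [N + g N], hence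
   inside the window starting at [N]. *)
have pN : (N + g N <= p)%N.
  rewrite -(ler_nat R) -(ler_pM2l b_gt0).
  have : delta b eta e * p%:R <= b * p%:R by rewrite ler_wpM2r // /delta ge_min lexx.
  have : 0 <= b * (N + g N)%:R by rewrite mulr_ge0 // ltW.
  by lra.
have p0 : (0 < p)%N by lia.
have pL : (2 * p <= maxn (N + g N + 2 * p) (h N))%N by lia.
have nN' : (N <= n <= N + (g N + p))%N by lia.
have mN' : (N <= m <= N + (g N + p))%N by lia.
have pN' : (N <= p <= N + (g N + p))%N by lia.
have distp := mean_dist_le_midpoint aff n0 m0 nN' mN' p0 pL.
have nmp : (n + m)%:R * b / p%:R <= delta b eta e / 3.
  rewrite ler_pdivrMr ?ltr0n //.
  have : (n + m)%:R <= 2 * (N + g N)%:R :> R by rewrite -natrM ler_nat; lia.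
  by move=> /(ler_wpM2r (ltW b_gt0)); lra.
pose r := Num.max (mean_dist n) (mean_dist m).
have rp : r - delta b eta e < mean_dist p.
  have := distN n p nN' pN'; have := distN m p mN' pN'.
  rewrite !ltr_norml => /andP[_ mp] /andP[_ np].
  by rewrite /r ltrBlDr gt_max; apply/andP; split; lra.
have rb : r <= b.
  by rewrite ge_max !(mean_dist_le C_segment T_fun T_ne C_diam Cx Cf).
have := midpoint_norm_le (u := S n n - f) (v := S m m - f) (r := r) eta_mod e0 _ _ rb _.
rewrite /r !le_max !lexx orbT => /(_ isT isT).
rewrite opprB addrA subrK => /(_ enm) mid.
have E0 : 0 < e * eta (e / (2 * b)).
  by rewrite mulr_gt0 // (eta_gt0 eta_mod) // divr_gt0 // mulr_gt0.
have : delta b eta e <= e / 8 * eta (e / (2 * b)).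
  by rewrite /delta !ge_min lexx !orbT.
(* The errors [delta], [delta / 4] and [delta / 3] add up to less than [2 * delta], which is at most
   half the gain from uniform convexity. *)
move: mid rp; rewrite -/r; lra.
Qed.

(** A mean of large length [p] is almost invariant under shifts by [l <= h N]. Passing from
    [T^l (S n n)] to [T^l (S p p)], [S p (p + l)], [S p p] and back to [S n n] costs at most [e / 4]
    at each of four steps. The choice [p = N + k] stays in the window and gives
    [l * b / p <= e / 4]. *)
Lemma psi_spec (B : rate R) :
  (forall e g h, 0 < e ->
    exists2 N, (N <= B e g h)%N & approx_affine T x e N (g N) (h N)) ->
  forall e g h, 0 < e ->
  exists N, [/\ (0 < N)%N, (N <= Psi b eta B e g h)%N &
    forall n l, (N <= n <= N + g N)%N -> (l <= h N)%N ->
      `|iter l T (S n n) - S n n| < e].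
Proof.
move=> Bspec e g h e0; have e4 : 0 < e / 4 by rewrite divr_gt0.
have [N [N0 NP aff SN]] := delta_spec Bspec
  (fun N => maxn (g N) (natceil (4 * b * (h N)%:R / e))) h e4.
exists N; split=> // n l nN lh; move: aff SN => /=.
set k := natceil _ => aff SN; pose p := (N + k)%N.
have p0 : (0 < p)%N by rewrite /p; lia.
have n0 : (0 < n)%N by lia.
have pN : (N <= p <= N + maxn (g N) k)%N by rewrite /p; lia.
have nN' : (N <= n <= N + maxn (g N) k)%N by lia.
have [_ Tlne] := nonexpansive_iter l T_fun T_ne.
have lb : l%:R * b / p%:R <= e / 4.
  rewrite ler_pdivrMr ?ltr0n //.
  have hk : 4 * b * (h N)%:R / e <= k%:R.
    by apply: natceil_ge; apply: divr_ge0 (ltW e0); rewrite !mulr_ge0 // ltW.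
  have : k%:R <= p%:R :> R by rewrite ler_nat /p leq_addl.
  move/(le_trans hk); rewrite ler_pdivrMr //.
  have : l%:R <= (h N)%:R :> R by rewrite ler_nat.
  by move=> /(ler_wpM2r (ltW b_gt0)); lra.
have := SN n p nN' pN.
have := Tlne _ _ (SC n n0) (SC p p0).
have := approx_affine_mean aff p0 pN lh.
have := orbit_mean_shift b_gt0 T_fun T_ne C_diam Cx p l p0.
have := ler_distD (iter l T (S p p)) (iter l T (S n n)) (S n n).
have := ler_distD (S p (p + l)) (iter l T (S p p)) (S n n).
have := ler_distD (S p p) (S p (p + l)) (S n n).
rewrite [`|S p p - S n n|]distrC; lra.
Qed.

End Delta.

Theorem theorem4p9 (R : realType) (X : completeNormedModType R)
    (C : set X) (b : R) (T : X -> X) (eta : R -> R) (c q : R) (x : X)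
    (A : rate R)
    (X_uc : uniformly_convex X)
    (C_neq0 : C !=set0) (C_closed : closed C) (C_convex : @convex_set R X C)
    (b_gt0 : 0 < b) (C_bounded : forall y, C y -> `|y| <= b / 2)
    (T_fun : set_fun C C T) (T_nonexpansive : nonexpansive_on C T)
    (T_fixpoint : exists2 y, C y & T y = y)
    (eta_modulus : convexity_modulus X eta)
    (c_gt0 : 0 < c) (q_gt1 : 1 < q) (cq_type : type_inequality X c q)
    (Cx : C x) (A_rate : displacement_rate T x A)
    (e : R) (e_gt0 : 0 < e) (g h : nat -> nat) :
  exists N : nat,
    [/\ (0 < N)%N, (N <= Psi b eta (rateB b c q eta A) e g h)%N &
        forall n l : nat, (N <= n <= N + g N)%N -> (l <= h N)%N ->
          `|iter l T (ergodic_mean T n (iter n T x))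
            - ergodic_mean T n (iter n T x)| < e].
Proof.
have C_segment := convex_set_segment C_convex.
have C_diam y z : C y -> C z -> `|y - z| <= b.
  by move=> /C_bounded yb /C_bounded zb; have := ler_normB y z; lra.
have [f Cf Tf] := T_fixpoint.
apply: (psi_spec b_gt0 C_segment T_fun T_nonexpansive C_diam Cx Cf Tf eta_modulus) => //.
move=> e' g' h' e'0.
exact: (rateB_approx_affine b_gt0 C_segment T_fun T_nonexpansive C_diam Cx
  c_gt0 q_gt1 cq_type eta_modulus A_rate).
Qed.
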